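(* Let $\mathbb{F}_q$ be a finite field, let $n_1,n_2$ be positive integers, and let $$\hat{\mathcal{R}}=\frac{\mathbb{F}_q[x,y]}{\langle x^{n_1}-1,\,y^{n_2}-1\rangle},\qquad \mathcal{R}_x=\frac{\mathbb{F}_q[x]}{\langle x^{n_1}-1\rangle},\qquad \mathcal{R}_y=\frac{\mathbb{F}_q[y]}{\langle y^{n_2}-1\rangle}.$$ Let $k_1,k_2$ be nonnegative integers and suppose that $(x-1)^{k_1}\mid x^{n_1}-1$ in $\mathbb{F}_q[x]$ and $(y-1)^{k_2}\mid y^{n_2}-1$ in $\mathbb{F}_q[y]$. Then the code $C=\langle (x-1)^{k_1}(y-1)^{k_2}\rangle\subset\hat{\mathcal{R}}$ is the product of the codes $C_x=\langle(x-1)^{k_1}\rangle\subset\mathcal{R}_x$ and $C_y=\langle(y-1)^{k_2}\rangle\subset\mathcal{R}_y$, i.e. $C=C_x\otimes C_y$.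
   Context: Ideals are regarded as linear codes: an element of $\hat{\mathcal{R}}$ has a unique representative $\sum_{0\le i<n_1,\,0\le j<n_2}c_{ij}x^iy^j$ and is identified with the two-dimensional array $(c_{ij})$; elements of $\mathcal{R}_x$ and $\mathcal{R}_y$ are likewise identified with their coefficient vectors of length $n_1$ and $n_2$. The product $C\otimes C'$ of two linear codes over $\mathbb{F}_q$ is the linear code of all two-dimensional arrays in which each row is a codeword of $C$ and each column is a codeword of $C'$. Here this means that $C_x\otimes C_y$ consists of all arrays $(c_{ij})$ such that $\sum_i c_{ij}x^i\in C_x$ for every fixed $j$ and $\sum_j c_{ij}y^j\in C_y$ for every fixed $i$. *)

(* Defs.v *)
From HB Require Import structures.
From mathcomp Require Import all_boot all_order all_algebra.
From mathcomp Require Import generic_quotient ring_quotient.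
From mathcomp Require Import boolp classical_sets.

Set Implicit Arguments.
Unset Strict Implicit.
Unset Printing Implicit Defensive.

Import GRing.Theory.
Local Open Scope ring_scope.
Local Open Scope quotient_scope.
Local Open Scope classical_set_scope.

Definition ideal_gen (R : comNzRingType) (gs : seq R) : set R :=
  [set u | exists c : 'I_(size gs) -> R, u = \sum_i c i * gs`_i].

(* F[x, y] is {poly {poly F}} as in polyXY: x is the outer variable 'X and y
   is the inner one 'Y := 'X%:P. *)
Definition cyclic2_ideal (F : fieldType) (n1 n2 : nat) :
    {pred {poly {poly F}}} :=
  fun p => `[< ideal_gen [:: 'X^n1 - 1; 'Y ^+ n2 - 1] p >].
Arguments cyclic2_ideal F n1 n2 : clear implicits.

Lemma cyclic2_idealP (F : fieldType) (n1 n2 : nat) (p : {poly {poly F}}) :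
  reflect (exists a b, p = a * ('X^n1 - 1) + b * ('Y ^+ n2 - 1))
          (p \in cyclic2_ideal F n1 n2).
Proof.
apply: (iffP (asboolP _)) => [[c ->]|[a [b ->]]].
  by rewrite /= big_ord_recl big_ord1; do 2!eexists.
exists (fun i => if val i == 0%N then a else b).
by rewrite /= big_ord_recl big_ord1.
Qed.

Fact cyclic2_ideal_closed (F : fieldType) (n1 n2 : nat) :
  idealr_closed (cyclic2_ideal F n1 n2).
Proof.
split.
- by apply/cyclic2_idealP; exists 0, 0; rewrite !mul0r addr0.
- apply/cyclic2_idealP => -[a [b /(congr1 (fun u => u.[1, 1]))]].
  by rewrite !hornerE !expr1n !subrr !hornerE => /eqP; rewrite oner_eq0.
- move=> u p q /cyclic2_idealP[a [b ->]] /cyclic2_idealP[c [d ->]].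
  apply/cyclic2_idealP; exists (u * a + c), (u * b + d).
  by rewrite mulrDr !mulrDl !mulrA addrACA.
Qed.

HB.instance Definition _ (F : fieldType) (n1 n2 : nat) :=
  isIdealr.Build {poly {poly F}} (cyclic2_ideal F n1 n2)
    (@cyclic2_ideal_closed F n1 n2).

Notation cyclic2_ring F n1 n2 := {ideal_quot (cyclic2_ideal F n1 n2)}.

Definition to_cyclic2 (F : fieldType) (n1 n2 : nat) (p : {poly {poly F}}) :
  cyclic2_ring F n1 n2 := \pi p.

(* 'X^n - 1 is monic of size > 1 only for 0 < n; for n = 0, {poly %/ _} is
   not F[x]/<x^n - 1>. *)
Notation cyclic_ring F n := {poly %/ ('X^n - 1 : {poly F})}.

Definition to_cyclic (F : fieldType) (n : nat) (p : {poly F}) :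
  cyclic_ring F n := in_qpoly ('X^n - 1) p.

Definition vec_class (F : fieldType) (n : nat) (c : 'rV[F]_n) :
    cyclic_ring F n :=
  to_cyclic n (\sum_(i < n) c 0 i *: 'X^i).

Definition array_class (F : fieldType) (n1 n2 : nat) (c : 'M[F]_(n1, n2)) :
    cyclic2_ring F n1 n2 :=
  to_cyclic2 n1 n2
    (\sum_(i < n1) \sum_(j < n2) (c i j)%:P%:P * 'X^i * 'Y ^+ j).

(* Subsets of the quotient rings viewed as codes: for positive n, n1, n2 every
   class has a unique reduced representative, that is, vec_class and
   array_class are bijective. *)
Definition vec_code (F : fieldType) (n : nat) (I : set (cyclic_ring F n)) :
    set 'rV[F]_n :=
  [set c | I (vec_class c)].

Definition array_code (F : fieldType) (n1 n2 : nat)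
    (I : set (cyclic2_ring F n1 n2)) : set 'M[F]_(n1, n2) :=
  [set c | I (array_class c)].

(* The exponent of x is the row index of the matrix, so the vector
   (c_ij)_i attached to a fixed j is a column of it. *)
Definition prod_code (F : fieldType) (n1 n2 : nat)
    (Cx : set 'rV[F]_n1) (Cy : set 'rV[F]_n2) : set 'M[F]_(n1, n2) :=
  [set c | (forall j, Cx (col j c)^T) /\ (forall i, Cy (row i c))].

(* Main.v *)
(* Let g = (x - 1)^k1 and h = (y - 1)^k2.  As h divides y^n2 - 1, the polynomial
   P(x, y) of an array of C is a multiple of h(y) modulo x^n1 - 1.  Reduction
   modulo this monic polynomial is F[y]-linear and fixes P, whose x-degree is
   below n1, so every coefficient of P in F[y] is a multiple of h; the other
   direction is symmetric.  Conversely, if P = h(y) Q = g(x) B, then reducing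
   modulo the monic g(x) shows that h(y) times the remainder of Q vanishes, so
   g(x) divides Q. *)
Require Import Defs.
From HB Require Import structures.
From mathcomp Require Import all_boot all_order all_algebra.
From mathcomp Require Import generic_quotient ring_quotient.
From mathcomp Require Import boolp classical_sets.

Import GRing.Theory.
Local Open Scope ring_scope.

Lemma ideal_gen1P (R : comNzRingType) (g u : R) :
  ideal_gen [:: g] u <-> exists a, u = a * g.
Proof.
split=> [[c ->]|[a ->]]; first by exists (c ord0); rewrite big_ord1.
by exists (fun=> a); rewrite big_ord1.
Qed.

Definition vec_poly {F : fieldType} {n : nat} (c : 'rV[F]_n) : {poly F} :=
  \sum_(i < n) c 0 i *: 'X^i.

Definition array_poly {F : fieldType} {n1 n2 : nat} (c : 'M[F]_(n1, n2)) :
    {poly {poly F}} :=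
  \sum_(i < n1) \sum_(j < n2) (c i j)%:P%:P * 'X^i * 'Y ^+ j.

Lemma array_polyE (F : fieldType) (n1 n2 : nat) (c : 'M[F]_(n1, n2)) :
  array_poly c = \sum_(i < n1) vec_poly (row i c) *: 'X^i.
Proof.
apply: eq_bigr => i _; rewrite scaler_suml; apply: eq_bigr => j _.
by rewrite mxE -mul_polyC -mul_polyC rmorphM rmorphXn mulrAC.
Qed.

(** This symmetry lets every fact about columns follow from the one about rows. *)
Lemma array_poly_tr (F : fieldType) (n1 n2 : nat) (c : 'M[F]_(n1, n2)) :
  array_poly c^T = swapXY (array_poly c).
Proof.
rewrite /array_poly exchange_big linear_sum; apply: eq_bigr => i _ /=.
rewrite linear_sum; apply: eq_bigr => j _ /=.
rewrite !rmorphM !rmorphXn /= swapXY_polyC map_polyC swapXY_X swapXY_Y mxE.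
by rewrite mulrAC.
Qed.

Lemma in_qpoly_eq0 (R : comNzRingType) (d p : {poly R}) :
  d \is monic -> (1 < size d)%N -> in_qpoly d p = 0 ->
  Pdiv.Ring.rdvdp d p.
Proof.
move=> d_monic d_gt1 /(congr1 val)/=.
(* The quotient is taken by [mk_monic d], which is [d] itself only for [d] monic and nonconstant. *)
by rewrite /mk_monic d_gt1 d_monic => /eqP.
Qed.

(** As [g] divides ['X^n - 1], divisibility by [g] does not depend on the representative of a
    class. *)
Lemma in_vec_code (F : fieldType) (n : nat) (g : {poly F}) (c : 'rV[F]_n) :
  (0 < n)%N -> g %| 'X^n - 1 ->
  vec_code (ideal_gen [:: to_cyclic n g]) c <-> g %| vec_poly c.
Proof.
move=> n_gt0 dvd_g.
rewrite /vec_code /= ideal_gen1P /vec_class -/(vec_poly c) /to_cyclic; split.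
  case=> u eq_c.
  have : in_qpoly ('X^n - 1) (vec_poly c - val u * g) = 0.
    rewrite raddfB /= in_qpolyM eq_c.
    rewrite -[X in X * _ - _](_ : in_qpoly _ (val u) = _).
      by rewrite subrr.
    by apply: val_inj; apply: in_qpoly_small; apply: size_mk_monic.
  move/in_qpoly_eq0; rewrite monicXnsubC // size_XnsubC // -dvdpE.
  move=> /(_ isT n_gt0)/(dvdp_trans dvd_g).
  by rewrite dvdp_subl // dvdp_mull.
by move=> /dvdpP[q ->]; exists (in_qpoly _ q); rewrite in_qpolyM.
Qed.

Lemma in_array_code (F : fieldType) (n1 n2 : nat) (G : {poly {poly F}})
    (c : 'M[F]_(n1, n2)) :
  array_code (ideal_gen [:: to_cyclic2 n1 n2 G]) c <->
  exists a b d,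
    array_poly c = a * G + (b * ('X^n1 - 1) + d * ('Y ^+ n2 - 1)).
Proof.
rewrite /array_code /= ideal_gen1P /array_class -/(array_poly c) /to_cyclic2.
split=> [[u]|[a [b [d ->]]]].
  rewrite -[u]reprK -rmorphM /= => /eqP; rewrite -Quotient.idealrBE.
  move=> /cyclic2_idealP[b [d E]]; exists (repr u), b, d.
  by rewrite -E addrC subrK.
exists (\pi a)%qT; rewrite -rmorphM /=; apply/eqP; rewrite -Quotient.idealrBE.
by apply/cyclic2_idealP; exists b, d; rewrite addrC addKr.
Qed.

(** The witness is the remainder of [A]. The coefficients will be in [{poly F}], not a field, hence
    ring division by a monic divisor. *)
Lemma scale_of_scale_modXnsub1 (R : comNzRingType) (n : nat) (h : R) (P A b : {poly R}) :
  (0 < n)%N -> (size P <= n)%N -> P = h%:P * A + b * ('X^n - 1) ->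
  exists Q, P = h *: Q.
Proof.
move=> n_gt0 szP PE.
have Xn1_monic : ('X^n - 1 : {poly R}) \is monic by apply: monicXnsubC.
exists (Pdiv.Ring.rmodp A ('X^n - 1)).
rewrite -Pdiv.RingMonic.rmodpZ // -mul_polyC.
rewrite -[LHS](@Pdiv.Ring.rmodp_small _ _ ('X^n - 1)) ?size_XnsubC //.
by rewrite PE Pdiv.RingMonic.rmodpD // Pdiv.RingMonic.rmodp_mull // addr0.
Qed.

Lemma size_array_poly (F : fieldType) (n1 n2 : nat) (c : 'M[F]_(n1, n2)) :
  (size (array_poly c) <= n1)%N.
Proof.
rewrite array_polyE; apply: (leq_trans (size_sum _ _ _)).
apply/bigmax_leqP => i _; apply: (leq_trans (size_scale_leq _ _)).
by rewrite size_polyXn.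
Qed.

Lemma coef_array_poly (F : fieldType) (n1 n2 : nat) (c : 'M[F]_(n1, n2)) i :
  (array_poly c)`_(i : 'I_n1) = vec_poly (row i c).
Proof.
rewrite array_polyE coef_sum (bigD1 i) //= coefZ coefXn eqxx mulr1.
rewrite big1 ?addr0 // => k k_neq; rewrite coefZ coefXn.
by rewrite (negbTE (_ : i != k :> nat)) ?mulr0 // eq_sym.
Qed.

(** The cofactor [A] is arbitrary so that it can absorb the generator in the other variable. *)
Lemma dvd_row_array_poly (F : fieldType) (n1 n2 : nat) (h : {poly F})
    (c : 'M[F]_(n1, n2)) (A b d : {poly {poly F}}) :
  (0 < n1)%N -> h %| 'X^n2 - 1 ->
  array_poly c = A * h%:P + (b * ('X^n1 - 1) + d * ('Y ^+ n2 - 1)) ->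
  forall i, h %| vec_poly (row i c).
Proof.
move=> n1_gt0 /dvdpP[w wE] PE i.
have [||Q PQ] :=
  @scale_of_scale_modXnsub1 _ n1 h (array_poly c) (A + d * w%:P) b n1_gt0.
- exact: size_array_poly.
(* The [d] term is thus itself a multiple of [h], whence the cofactor [A + d * w%:P]. *)
- have Yn1E : 'Y ^+ n2 - 1 = w%:P * h%:P :> {poly {poly F}}.
    by rewrite -rmorphM -wE rmorphB rmorphXn rmorph1.
  by rewrite PE Yn1E mulrA mulrC [_ * h%:P]mulrC addrCA addrC -mulrDr.
by rewrite -coef_array_poly PQ coefZ dvdp_mulr.
Qed.

Lemma array_poly_dvd_row (F : fieldType) (n1 n2 : nat) (h : {poly F})
    (c : 'M[F]_(n1, n2)) :
  (forall i, h %| vec_poly (row i c)) ->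
  exists Q, array_poly c = h%:P * Q.
Proof.
move=> dvd_h; exists (\sum_i (vec_poly (row i c) %/ h) *: 'X^i).
rewrite array_polyE mulr_sumr; apply: eq_bigr => i _.
by rewrite mul_polyC scalerA mulrC divpK.
Qed.

(** Powers of ['X - 1] enter only as monic divisors, so the argument is run for any such [g] and
    [h]; [g^:P] is g(x) and [h%:P] is h(y). *)
Lemma array_code_prod (F : fieldType) (n1 n2 : nat) (g h : {poly F}) :
  (0 < n1)%N -> (0 < n2)%N -> g \is monic -> h \is monic ->
  g %| 'X^n1 - 1 -> h %| 'X^n2 - 1 ->
  array_code (ideal_gen [:: to_cyclic2 n1 n2 (g^:P * h%:P)]) =
  prod_code (vec_code (ideal_gen [:: to_cyclic n1 g]))
            (vec_code (ideal_gen [:: to_cyclic n2 h])).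
Proof.
move=> n1_gt0 n2_gt0 g_monic h_monic dvd_g dvd_h; apply/seteqP; split=> c.
  move=> /in_array_code[a [b [d PE]]]; split=> [j|i]; apply/in_vec_code => //.
    rewrite tr_col.
    (* Swapping the variables exchanges the two relations, hence [d] now precedes [b]. *)
    apply: (@dvd_row_array_poly _ _ _ g c^T
              (swapXY (a * h%:P)) (swapXY d) (swapXY b)) => //.
    rewrite array_poly_tr PE.
    rewrite !(rmorphD, rmorphN, rmorphM, rmorphXn, rmorph1) /=.
    rewrite swapXY_map_polyC swapXY_X swapXY_Y.
    by rewrite mulrA [_ * g%:P * _]mulrAC [X in _ + X]addrC.
  apply: (@dvd_row_array_poly _ _ _ h c (a * g^:P) b d) => //.
  by rewrite PE mulrA.
move=> [col_g row_h]; apply/in_array_code.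
have [Q PQ] : exists Q, array_poly c = h%:P * Q.
  by apply: array_poly_dvd_row => i; apply/in_vec_code/row_h.
have [B PB] : exists B, array_poly c^T = g%:P * B.
  apply: array_poly_dvd_row => j; apply/in_vec_code => //.
  by rewrite -tr_col; apply: col_g.
have gP_monic : g^:P \is monic by rewrite map_monic.
have : Pdiv.Ring.rdvdp g^:P Q.
  (* Both factorizations describe the same polynomial, once that of the transpose is swapped
     back. *)
  have : Pdiv.Ring.rmodp (h *: Q) g^:P = 0.
    rewrite -mul_polyC -PQ -[array_poly c]swapXYK -array_poly_tr PB rmorphM /=.
    by rewrite swapXY_polyC mulrC Pdiv.RingMonic.rmodp_mull.
  rewrite Pdiv.RingMonic.rmodpZ // => /eqP.
  (* [h] is nonzero and can be cancelled in the domain F[y][x]. *)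
  by rewrite -mul_polyC mulf_eq0 polyC_eq0 (negbTE (monic_neq0 h_monic)).
move=> /(Pdiv.RingMonic.rdvdpP gP_monic)[a QE].
(* The factorization already holds in F[x, y], so both correction terms are zero. *)
by exists a, 0, 0; rewrite PQ QE !mul0r !addr0 mulrCA [h%:P * _]mulrC.
Qed.

Theorem theorem3p3 (F : finFieldType) (n1 n2 k1 k2 : nat)
    (n1_gt0 : (0 < n1)%N) (n2_gt0 : (0 < n2)%N)
    (dvd1 : ('X - 1 : {poly F}) ^+ k1 %| 'X^n1 - 1)
    (dvd2 : ('X - 1 : {poly F}) ^+ k2 %| 'X^n2 - 1) :
  array_code (ideal_gen
    [:: to_cyclic2 n1 n2 (('X - 1) ^+ k1 * ('Y - 1) ^+ k2 : {poly {poly F}})])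
  = prod_code
      (vec_code (ideal_gen [:: to_cyclic n1 (('X - 1) ^+ k1 : {poly F})]))
      (vec_code (ideal_gen [:: to_cyclic n2 (('X - 1) ^+ k2 : {poly F})])).
Proof.
rewrite -array_code_prod ?monic_exp ?monicXsubC //.
by rewrite !rmorphXn !rmorphB !rmorph1 /= map_polyX.
Qed.
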